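(* Let $H$ be a Hilbert $C^*$-module and let $P,Q\in\mathcal{L}(H)$ be projections such that $(P,Q)$ is semi-harmonious. Put $\mathcal{R}=\mathcal{R}(Q)\cap\mathcal{R}(P)$ and $\mathcal{N}=\mathcal{N}(Q)\cap\mathcal{N}(P)$. Then there exists a unitary $U\in\mathcal{L}(H)$ such that $$U(Q-P_{\mathcal{R}})U^*=I-P-P_{\mathcal{N}}\quad\text{and}\quad U(P-P_{\mathcal{R}})U^*=I-Q-P_{\mathcal{N}}.$$
   Context: For a Hilbert $C^*$-module $H$, $\mathcal{L}(H)$ denotes the $C^*$-algebra of all adjointable operators on $H$, and $I$ its unit. A projection is $P\in\mathcal{L}(H)$ with $P=P^*=P^2$. $\mathcal{R}(T)$ and $\mathcal{N}(T)$ denote the range and null space of $T$. A closed submodule $M\subseteq H$ is orthogonally complemented in $H$ if $H=M+M^\perp$, where $M^\perp=\{x\in H:\langle x,y\rangle=0\ \forall y\in M\}$; in that case $P_M\in\mathcal{L}(H)$ denotes the (unique) projection with range $M$. A pair $(P,Q)$ of projections on $H$ is semi-harmonious if both $\overline{\mathcal{R}(P+Q)}$ and $\overline{\mathcal{R}(2I-P-Q)}$ are orthogonally complemented in $H$. Since $\overline{\mathcal{R}(2I-P-Q)}^\perp=\mathcal{R}$ and $\overline{\mathcal{R}(P+Q)}^\perp=\mathcal{N}$, for a semi-harmonious pair both $\mathcal{R}$ and $\mathcal{N}$ are orthogonally complemented, so $P_{\mathcal{R}}$ and $P_{\mathcal{N}}$ are meaningful. *)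

(* Defs.v *)
From HB Require Import structures.
From mathcomp Require Import all_boot all_order all_algebra.
From mathcomp Require Import complex.
From mathcomp Require Import all_classical all_reals all_analysis.

Set Implicit Arguments.
Unset Strict Implicit.
Unset Printing Implicit Defensive.

Import Order.TTheory GRing.Theory Num.Theory.
Import numFieldNormedType.Exports.

Local Open Scope classical_set_scope.
Local Open Scope ring_scope.

(* C*-algebras over R[i] need not be unital, so their product is declared here
   and not taken from the ring hierarchy, whose rings all have a unit. *)
HB.mixin Record isCStarAlgebra (R : realType) A
    of CompleteNormedModule R[i] A := {
  cmul : A -> A -> A;
  cstar : A -> A;
  cmulA : forall a b c, cmul a (cmul b c) = cmul (cmul a b) c;
  cmulDl : forall a b c, cmul (a + b) c = cmul a c + cmul b c;
  cmulDr : forall a b c, cmul a (b + c) = cmul a b + cmul a c;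
  cmulZl : forall (k : R[i]) a b, cmul (k *: a) b = k *: cmul a b;
  cmulZr : forall (k : R[i]) a b, cmul a (k *: b) = k *: cmul a b;
  cstarK : forall a, cstar (cstar a) = a;
  cstarD : forall a b, cstar (a + b) = cstar a + cstar b;
  cstarZ : forall (k : R[i]) a, cstar (k *: a) = Num.conj k *: cstar a;
  cstarM : forall a b, cstar (cmul a b) = cmul (cstar b) (cstar a);
  normr_cmul : forall a b, `|cmul a b| <= `|a| * `|b|;
  normr_cstarM : forall a, `|cmul (cstar a) a| = `|a| ^+ 2 }.

#[short(type="cstarAlgType")]
HB.structure Definition CStarAlgebra (R : realType) :=
  {A of isCStarAlgebra R A & CompleteNormedModule R[i] A}.

Definition cpositive (R : realType) (A : cstarAlgType R) (a : A) : Prop :=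
  exists b : A, a = cmul (cstar b) b.

(* Right modules, with inner products that are linear in the second variable.
   [normr_ip] says that the norm of H, which defines its topology and for which
   it is complete, is the norm given by the inner product. *)
HB.mixin Record isHilbertModule (R : realType) (A : cstarAlgType R) H
    of CompleteNormedModule R[i] H := {
  act : H -> A -> H;
  ip : H -> H -> A;
  actA : forall x a b, act x (cmul a b) = act (act x a) b;
  actDl : forall x y a, act (x + y) a = act x a + act y a;
  actDr : forall x a b, act x (a + b) = act x a + act x b;
  actZl : forall (k : R[i]) x a, act (k *: x) a = k *: act x a;
  actZr : forall (k : R[i]) x a, act x (k *: a) = k *: act x a;
  ipDr : forall x y z, ip x (y + z) = ip x y + ip x z;
  ipZr : forall (k : R[i]) x y, ip x (k *: y) = k *: ip x y;
  ip_act : forall x y a, ip x (act y a) = cmul (ip x y) a;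
  ip_star : forall x y, cstar (ip x y) = ip y x;
  ip_positive : forall x, cpositive (ip x x);
  ip_eq0 : forall x, ip x x = 0 -> x = 0;
  normr_ip : forall x, `|x| ^+ 2 = `|ip x x| }.

#[short(type="hilbertModType")]
HB.structure Definition HilbertModule (R : realType) (A : cstarAlgType R) :=
  {H of isHilbertModule R A H & CompleteNormedModule R[i] H}.

Section InnerProduct.
Variables (R : realType) (A : cstarAlgType R) (H : hilbertModType A).
Implicit Types x y z : H.

Lemma cstar0 : cstar (0 : A) = 0.
Proof. by rewrite -[in LHS](scale0r (0 : A)) cstarZ conjC0 scale0r. Qed.

Lemma cstarN (a : A) : cstar (- a) = - cstar a.
Proof. by apply/eqP; rewrite -addr_eq0 -cstarD addNr cstar0. Qed.

Lemma ip0r x : ip x (0 : H) = 0.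
Proof. by rewrite -[in LHS](scale0r (0 : H)) ipZr scale0r. Qed.

Lemma ipNr x y : ip x (- y) = - ip x y.
Proof. by apply/eqP; rewrite -addr_eq0 -ipDr addNr ip0r. Qed.

Lemma ipBr x y z : ip x (y - z) = ip x y - ip x z.
Proof. by rewrite ipDr ipNr. Qed.

Lemma ip0l x : ip (0 : H) x = 0.
Proof. by rewrite -ip_star ip0r cstar0. Qed.

Lemma ipDl x y z : ip (x + y) z = ip x z + ip y z.
Proof. by rewrite -ip_star ipDr cstarD !ip_star. Qed.

Lemma ipNl x y : ip (- x) y = - ip x y.
Proof. by rewrite -ip_star ipNr cstarN ip_star. Qed.

Lemma ipBl x y z : ip (x - y) z = ip x z - ip y z.
Proof. by rewrite ipDl ipNl. Qed.

Lemma ip_inj x y : (forall z, ip z x = ip z y) -> x = y.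
Proof.
move=> xy; apply/eqP; rewrite -subr_eq0; apply/eqP/ip_eq0.
by rewrite ipBr xy subrr.
Qed.

End InnerProduct.

Section Adjointable.
Variables (R : realType) (A : cstarAlgType R) (H : hilbertModType A).

Definition is_adjoint (T S : H -> H) : Prop :=
  forall x y, ip (T x) y = ip x (S y).

Definition adjointable : {pred H -> H} :=
  fun T => `[< exists S, is_adjoint T S >].

Lemma is_adjoint_sym T S : is_adjoint T S -> is_adjoint S T.
Proof. by move=> TS x y; rewrite -ip_star -TS ip_star. Qed.

Lemma is_adjoint_unique T S1 S2 :
  is_adjoint T S1 -> is_adjoint T S2 -> S1 = S2.
Proof. by move=> h1 h2; apply/funext => y; apply: ip_inj => x; rewrite -h1. Qed.

Lemma is_adjoint_id : is_adjoint id id. Proof. by []. Qed.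

Lemma is_adjoint0 : is_adjoint 0 0.
Proof. by move=> x y; rewrite ip0l ip0r. Qed.

Lemma is_adjointB T1 S1 T2 S2 :
  is_adjoint T1 S1 -> is_adjoint T2 S2 -> is_adjoint (T1 - T2) (S1 - S2).
Proof. by move=> h1 h2 x y; rewrite ipBl ipBr h1 h2. Qed.

Lemma is_adjointM T1 S1 T2 S2 :
  is_adjoint T1 S1 -> is_adjoint T2 S2 -> is_adjoint (T1 \o T2) (S2 \o S1).
Proof. by move=> h1 h2 x y; rewrite /= h1 h2. Qed.

Fact adjointable_zmod_closed : zmod_closed adjointable.
Proof.
split=> [|T1 T2 /asboolP[S1 h1] /asboolP[S2 h2]]; apply/asboolP.
- by exists 0; exact: is_adjoint0.
- by exists (S1 - S2); exact: is_adjointB.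
Qed.

HB.instance Definition _ :=
  GRing.isZmodClosed.Build (H -> H) adjointable adjointable_zmod_closed.

(* L(H), made into a ring below with composition as the product *)
Record adjop := AdjOp { opfun :> H -> H; _ : opfun \in adjointable }.

HB.instance Definition _ := [isSub for opfun].
HB.instance Definition _ := [Choice of adjop by <:].
HB.instance Definition _ := [SubChoice_isSubZmodule of adjop by <:].

Implicit Types T S P Q : adjop.

Lemma adjopP T S : T = S <-> forall x, T x = S x.
Proof. by split=> [-> //|TS]; apply: val_inj; apply/funext. Qed.

Lemma adjoint_exists T : exists S : adjop, is_adjoint T S.
Proof.
case: T => T /= aT; have /asboolP[S TS] := aT.
have aS : S \in adjointable by apply/asboolP; exists T; exact: is_adjoint_sym.
by exists (AdjOp aS).
Qed.

Definition adjoint T : adjop := projT1 (cid (adjoint_exists T)).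

Lemma adjointP T x y : ip (T x) y = ip x (adjoint T y).
Proof. by rewrite /adjoint; case: cid => S /= ->. Qed.

Fact adjop_one_subproof : id \in adjointable.
Proof. by apply/asboolP; exists id. Qed.

Fact adjop_mul_subproof T S : T \o S \in adjointable.
Proof.
by apply/asboolP; exists (adjoint S \o adjoint T); apply: is_adjointM;
   exact: adjointP.
Qed.

Definition adjop_one := AdjOp adjop_one_subproof.
Definition adjop_mul T S := AdjOp (adjop_mul_subproof T S).

Lemma adjopD T x y : T (x + y) = T x + T y.
Proof.
by apply: ip_inj => z; rewrite ipDr -!(is_adjoint_sym (adjointP T)) ipDr.
Qed.

Fact adjop_mulA : associative adjop_mul.
Proof. by move=> T1 T2 T3; apply/adjopP. Qed.
Fact adjop_mul1 : left_id adjop_one adjop_mul.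
Proof. by move=> T; apply/adjopP. Qed.
Fact adjop_1mul : right_id adjop_one adjop_mul.
Proof. by move=> T; apply/adjopP. Qed.
Fact adjop_mulDl : left_distributive adjop_mul +%R.
Proof. by move=> T1 T2 T3; apply/adjopP. Qed.
Fact adjop_mulDr : right_distributive adjop_mul +%R.
Proof. by move=> T1 T2 T3; apply/adjopP => x; exact: adjopD. Qed.

HB.instance Definition _ := GRing.Zmodule_isPzRing.Build adjop
  adjop_mulA adjop_mul1 adjop_1mul adjop_mulDl adjop_mulDr.

Lemma adjop0E x : (0 : adjop) x = 0. Proof. by []. Qed.
Lemma adjop1E x : (1 : adjop) x = x. Proof. by []. Qed.
Lemma adjopDE T S x : (T + S) x = T x + S x. Proof. by []. Qed.
Lemma adjopBE T S x : (T - S) x = T x - S x. Proof. by []. Qed.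
Lemma adjopME T S x : (T * S) x = T (S x). Proof. by []. Qed.

Definition projection (P : adjop) : Prop := adjoint P = P /\ P * P = P.

Definition unitary (U : adjop) : Prop := adjoint U * U = 1 /\ U * adjoint U = 1.

Definition null T : set H := [set x | T x = 0].

Definition orthogonal (M : set H) : set H :=
  [set x | forall y, M y -> ip x y = 0].

(* For any set M, this equation makes M equal to its double orthogonal, hence a
   closed submodule of H. *)
Definition orth_complemented (M : set H) : Prop :=
  [set: H] = [set x + y | x in M & y in orthogonal M].

Lemma orthogonalP (M : set H) x y : orthogonal M x -> M y -> ip y x = 0.
Proof. by move=> xM My; rewrite -ip_star xM // cstar0. Qed.

Lemma orth_decomp_unique (M : set H) x1 y1 x2 y2 :
    M x1 -> orthogonal M y1 -> M x2 -> orthogonal M y2 ->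
  x1 + y1 = x2 + y2 -> x1 = x2.
Proof.
move=> Mx1 oy1 Mx2 oy2 e; apply/eqP; rewrite -subr_eq0; apply/eqP/ip_eq0.
have {1}-> : x1 - x2 = y2 - y1.
  by apply/eqP; rewrite subr_eq addrAC eq_sym subr_eq addrC e addrC.
by rewrite ipBl !ipBr !oy1 // !oy2 // !subrr.
Qed.

Lemma projection_adjoint P : projection P -> is_adjoint P P.
Proof. by move=> [PP _] x y; rewrite adjointP PP. Qed.

Lemma projection_range P x : projection P -> range P x -> P x = x.
Proof. by move=> [_ PP] [y _ <-]; rewrite -adjopME PP. Qed.

Lemma projection_unique P Q :
  projection P -> projection Q -> range P = range Q -> P = Q.
Proof.
move=> pP pQ PQ; have PQP x : Q (P x) = P x.
  by apply: projection_range => //; rewrite -PQ; exists x.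
have QPQ x : P (Q x) = Q x.
  by apply: projection_range => //; rewrite PQ; exists x.
apply/adjopP => x; apply: ip_inj => z.
rewrite -[in RHS]QPQ -!(projection_adjoint pP) -[in LHS]PQP.
by rewrite (projection_adjoint pQ).
Qed.

(* The projection with range M, and 0 if there is none *)
Definition proj_on (M : set H) : adjop :=
  xget 0 [set P | projection P /\ range P = M].

Lemma proj_onP (M : set H) :
  orth_complemented M -> projection (proj_on M) /\ range (proj_on M) = M.
Proof.
move=> cM; have dec x : exists y, M y /\ orthogonal M (x - y).
  have : [set: H] x by [].
  by rewrite cM => -[y My [z oz <-]]; exists y; rewrite addrC addKr.
pose p x := projT1 (cid (dec x)).
have pM x : M (p x) by rewrite /p; case: cid => y /= [].
have po x : orthogonal M (x - p x) by rewrite /p; case: cid => y /= [].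
have pp : is_adjoint p p.
  move=> x y; rewrite -[y in LHS](subrK (p y)) -[x in RHS](subrK (p x)).
  by rewrite ipDr ipDl (orthogonalP (po y)) // po.
have pid x : M x -> p x = x.
  move=> Mx; apply: (@orth_decomp_unique M (p x) (x - p x) x 0) => //.
    by move=> y My; rewrite ip0l.
  by rewrite addrC subrK addr0.
have ap : p \in adjointable by apply/asboolP; exists p.
apply: (@xgetPex _ 0 [set P | projection P /\ range P = M]); exists (AdjOp ap).
split; first split.
- apply: val_inj; exact: (@is_adjoint_unique p _ _ (adjointP (AdjOp ap)) pp).
- by apply/adjopP => x; apply: pid.
- by apply/seteqP; split=> [_ [x _ <-]//|x Mx]; exists x => //; exact: pid.
Qed.

Definition semi_harmonious (P Q : adjop) : Prop :=
  orth_complemented (closure (range (P + Q))) /\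
  orth_complemented (closure (range (2%:R - P - Q))).

End Adjointable.

(* Main.v *)
Require Import Defs.
From mathcomp Require Import all_boot all_order all_algebra.
From mathcomp Require Import complex ring lra.
From mathcomp Require Import all_classical all_reals all_analysis.

Set Implicit Arguments.
Unset Strict Implicit.
Unset Printing Implicit Defensive.

Import Order.TTheory GRing.Theory Num.Theory.
Import numFieldNormedType.Exports.

Local Open Scope classical_set_scope.
Local Open Scope ring_scope.

(** Put D = P - Q. The identities D P = (1 - Q) D and D Q = (1 - P) D say that D
    exchanges P with 1 - Q and Q with 1 - P, and so does the sign of D. On the null
    space of D, which is the orthogonal sum of the two intersections R of the
    ranges and N of the null spaces, the operators Q - P_R, P - P_R, 1 - P - P_N
    and 1 - Q - P_N all vanish, so U may be taken to be the sign of D completed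
    by the identity there. What has to be shown is that U exists as an adjointable
    operator.

    An absolute value S of D comes from an iteration ([sqrt_exists]): as
    (P - Q)^2 + (P + Q - 1)^2 = 1 and P + Q - 1 is a contraction, S is the square
    root of 1 - B for the self-adjoint contraction B = (P + Q - 1)^2. It commutes
    with P and Q. The map S x + z |-> D x + z, for z in the null space of D, is then
    isometric and symmetric, so it extends to a self-adjoint unitary as soon as
    the vectors S x + z are dense ([sign_exists]).

    Density is what semi-harmony gives ([pair_dense]). It would be automatic in a
    Hilbert space, but a closed submodule of a Hilbert C*-module need not be
    complemented. Since D^2 = (P + Q) (2 - P - Q), decomposing H along the
    closures of the ranges of the two factors reaches every vector as a limit of
    vectors D^2 w + z.

    Positivity in the C*-algebra is avoided throughout. Operators are bounded by
    writing them as means of self-adjoint involutions, which are isometric, and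
    the inner product is continuous by polarization and the triangle inequality
    in H. *)

(** * Midpoints and convergence of sequences *)

Lemma half_add (K : numFieldType) (V : lmodType K) (x : V) :
  2%:R^-1 *: (x + x) = x.
Proof.
by rewrite -{1 2}[x]scale1r -scalerDl scalerA mulVf ?scale1r // pnatr_eq0.
Qed.

Lemma norm_half (K : numFieldType) (V : normedModType K) (x : V) :
  `|2%:R^-1 *: x| = 2%:R^-1 * `|x|.
Proof. by rewrite normrZ normfV normr_nat. Qed.

Lemma norm_half_add (K : numFieldType) (V : normedModType K) (x y z : V) :
  `|x| <= `|z| -> `|y| <= `|z| ->
  `|2%:R^-1 *: (x + y)| <= `|z|.
Proof.
move=> xz yz; rewrite norm_half [leRHS]splitr -mulrDl mulrC ler_wpM2r //.
by rewrite (le_trans (ler_normD _ _)) ?lerD.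
Qed.

Section Sequences.
Variables (R : realType) (V : normedModType R[i]).
Implicit Types (u v : nat -> V) (x y : V).

Lemma complex_archimedean (e : R[i]) :
  0 < e -> exists N : nat, forall n, (N <= n)%N -> n.+1%:R^-1 < e.
Proof.
move=> e0; have [r er] : exists r : R, e = r%:C%C.
  by exists (complex.Re e); rewrite RRe_real// gtr0_real.
subst e; move: e0; rewrite -[0]/(0%:C%C) ltcR => r0.
have [N _ hN] := near_infty_natSinv_lt (PosNum r0).
exists N => n Nn; have := hN n Nn; rewrite /= -ltcR.
by rewrite rmorphV ?rmorph_nat // unitfE pnatr_eq0.
Qed.

(** Points of the closure are handled through sequences, so that the choice of
    an approximating sequence is available when an operator is extended. *)
Lemma closureP (E : set V) x :
  closure E x <->
  exists u : nat -> V, (forall n, E (u n)) /\ u n @[n --> \oo] --> x.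
Proof.
split=> [Ex | [u [Eu ux]] B Bx].
  have /choice[u uP] : forall n : nat, exists y, E y /\ `|x - y| < n.+1%:R^-1.
    move=> n; have [|y [Ey By]] := Ex (ball x n.+1%:R^-1).
      by apply: nbhsx_ballx; rewrite invr_gt0 ltr0n.
    by exists y; split=> //; move: By; rewrite -ball_normE.
  exists u; split=> [n|]; first by have [] := uP n.
  apply/cvgrPdist_lt => e /complex_archimedean[N hN].
  by exists N => //= n Nn; have [_ /lt_trans] := uP n; apply; exact: hN.
have [N _ hN] := ux _ Bx.
by exists (u N); split => //; apply: hN; rewrite /=.
Qed.

End Sequences.

Lemma cvg_of_cauchy (R : realType) (V : completeNormedModType R[i])
    (u : nat -> V) :
  (forall e : R[i], 0 < e -> exists N : nat,
     forall n, (N <= n)%N -> `|u N - u n| < e) ->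
  exists x : V, u n @[n --> \oo] --> x.
Proof.
move=> cu; have /cauchy_cvg ux : cauchy (u n @[n --> \oo]).
  apply: cauchy_exP => e /cu[N hN]; exists (u N); rewrite -ball_normE.
  by exists N => // n; exact: hN.
by exists (lim (u n @[n --> \oo])).
Qed.

Section SequentialContinuity.
Variables (R : realType) (V : normedModType R[i]).
Implicit Types f g : V -> V.

Definition seq_continuous f := forall (u : nat -> V) x,
  u n @[n --> \oo] --> x -> f (u n) @[n --> \oo] --> f x.

Lemma seq_continuousB f g : seq_continuous f -> seq_continuous g ->
  seq_continuous (fun x => f x - g x).
Proof. by move=> fc gc u x ux; apply: cvgB; [exact: fc|exact: gc]. Qed.

Lemma seq_continuous_closure f (E F : set V) : seq_continuous f ->
  (forall x, E x -> closure F (f x)) -> forall x, closure E x -> closure F (f x).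
Proof.
move=> fc EF x /closureP[u [Eu ux]].
have -> : closure F = closure (closure F).
  by rewrite -closure_id; exact: closed_closure.
by apply/closureP; exists (f \o u); split=> [n|]; [exact: EF|exact: fc].
Qed.

Lemma seq_continuous_dense f g (E : set V) : seq_continuous f ->
  seq_continuous g -> (forall x, E x -> f x = g x) ->
  closure E = setT -> forall x, f x = g x.
Proof.
move=> fc gc fg dE x; have : closure E x by rewrite dE.
move=> /closureP[u [Eu ux]]; have c := fc _ _ ux.
apply: (norm_cvg_unique c); have -> : (fun n => f (u n)) = (fun n => g (u n)).
  by apply/funext => n; exact: fg.
exact: gc.
Qed.

End SequentialContinuity.

(** * Continuity of the inner product *)

Section InnerProductContinuity.
Variables (R : realType) (A : cstarAlgType R) (H : hilbertModType A).
Implicit Types x y z : H.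

Lemma ipZl (k : R[i]) x y : ip (k *: x) y = Num.conj k *: ip x y.
Proof. by rewrite -ip_star ipZr cstarZ ip_star. Qed.

Lemma eq_norm_ip x y : ip x x = ip y y -> `|x| = `|y|.
Proof.
by move=> xy; apply/eqP; rewrite -(eqrXn2 (n := 2)) // !normr_ip xy.
Qed.

(** A Cauchy-Schwarz inequality would need the order of the C*-algebra; the
    norm of H being a norm already bounds the inner product, by polarization:
    its symmetric part is a combination of values [ip z z]. *)
Lemma norm_ip_swap x y : `|ip x y + ip y x| <= 2%:R * (`|x| + `|y|) ^+ 2.
Proof.
have -> : ip x y + ip y x = ip (x + y) (x + y) - (ip x x + ip y y).
  rewrite ipDl !ipDr; apply/eqP; rewrite eq_sym subr_eq; apply/eqP.
  by rewrite (addrC (ip x x)) -!addrA; congr (_ + _); rewrite addrCA addrA addrC.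
apply: (le_trans (ler_normB _ _)); rewrite mulr_natl mulr2n lerD //.
  by rewrite -normr_ip lerXn2r ?nnegrE ?addr_ge0 ?ler_normD.
apply: (le_trans (ler_normD _ _)); rewrite -!normr_ip sqrrD -addrA lerD2l.
by rewrite ler_wpDl ?mulrn_wge0 // mulr_ge0.
Qed.

(** Replacing y by i y turns the symmetric part of the inner product into its
    skew-symmetric part, so both parts are bounded. *)
Lemma norm_ip_le_sum x y : `|ip x y| <= 2%:R * (`|x| + `|y|) ^+ 2.
Proof.
have two : 0 < 2%:R :> R[i] by rewrite ltr0n.
have e : 2%:R *: ip x y =
    (ip x y + ip y x) - 'i *: (ip x ('i *: y) + ip ('i *: y) x).
  rewrite ipZr ipZl conjCi scalerDr !scalerA mulrN -expr2 sqrCi opprK.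
  by rewrite scaleN1r scale1r opprD opprK addrACA subrr addr0 scaler_nat mulr2n.
rewrite -(ler_pM2l two) -[X in X * _ <= _]normr_nat -normrZ e.
apply: (le_trans (ler_normB _ _)).
rewrite [leRHS]mulr_natl mulr2n lerD ?norm_ip_swap //.
rewrite normrZ normCi mul1r; apply: (le_trans (norm_ip_swap _ _)).
by rewrite normrZ normCi mul1r.
Qed.

(** The bound by a square is rescaled on normalized vectors; the constant 8 is
    far from optimal, but any constant makes the inner product continuous. *)
Lemma norm_ip_le x y : `|ip x y| <= 8%:R * (`|x| * `|y|).
Proof.
have [->|x0] := eqVneq x 0; first by rewrite ip0l !normr0 mul0r mulr0.
have [->|y0] := eqVneq y 0; first by rewrite ip0r !normr0 !mulr0.
have nx : `|x| != 0 by rewrite normr_eq0.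
have ny : `|y| != 0 by rewrite normr_eq0.
have := norm_ip_le_sum (`|x|^-1 *: x) (`|y|^-1 *: y).
have unit (z : H) : `|z| != 0 -> `| `|z|^-1 *: z| = 1.
  by move=> z0; rewrite normrZ normrV ?unitfE // normr_id mulVf.
rewrite !unit // ipZl ipZr !normrZ norm_conjC.
rewrite !normrV ?unitfE // !normr_id -[1 + 1]/(2%:R) -natrX -natrM mulrA.
by rewrite -invfM mulrC ler_pdivrMr ?mulr_gt0 // normr_gt0.
Qed.

Lemma cvg_ip (u v : nat -> H) x y :
  u n @[n --> \oo] --> x -> v n @[n --> \oo] --> y ->
  ip (u n) (v n) @[n --> \oo] --> ip x y.
Proof.
move=> ux vy; apply/cvgrPdist_lt => e e0.
pose c := 8%:R * (`|x| + `|y| + 1).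
have c1 : 0 < `|x| + `|y| + 1 by rewrite ltr_wpDl ?addr_ge0.
have c0 : 0 < c by rewrite mulr_gt0 ?ltr0n.
pose d := e / 2%:R / c.
have d0 : 0 < d by rewrite !divr_gt0 ?ltr0n.
have bv : \forall n \near \oo, `|v n| <= `|x| + `|y| + 1.
  have [N _ hN] := (cvgrPdist_lt _ _).1 vy 1 ltr01.
  exists N => // n Nn /=; have vn := hN n Nn; rewrite /= in vn.
  rewrite -(subrK y (v n)) (le_trans (ler_normD _ _)) // addrC.
  by rewrite lerD ?lerDr // distrC ltW.
have dc : c * d = e / 2%:R by rewrite mulrC divfK // gt_eqF.
near=> n.
have -> : ip x y - ip (u n) (v n) = ip (x - u n) (v n) + ip x (y - v n).
  by rewrite ipBl ipBr [RHS]addrC subrKA.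
apply: (le_lt_trans (ler_normD _ _)).
rewrite [e]splitr ltr_leD //.
  apply: (le_lt_trans (norm_ip_le _ _)).
  rewrite (@le_lt_trans _ _ (c * `|x - u n|)) //.
    rewrite /c -mulrA ler_wpM2l ?ler0n // mulrC ler_wpM2r //.
    by near: n.
  rewrite -dc ltr_pM2l //; near: n; exact: (cvgrPdist_lt _ _).1 ux d d0.
apply: (le_trans (norm_ip_le _ _)).
rewrite (@le_trans _ _ (c * `|y - v n|)) //.
  by rewrite /c -mulrA ler_wpM2l ?ler0n // ler_wpM2r // -addrA lerDl addr_ge0.
rewrite -dc ler_pM2l //; near: n; exact: (cvgrPdist_le _ _).1 vy d d0.
Unshelve. all: by end_near.
Qed.

(** Symmetry, isometry and commutation of an operator defined as a limit are
    identities between inner products, and pass to the limit in this form. *)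
Lemma ip_lim_eq (u v u' v' : nat -> H) x y x' y' :
  u n @[n --> \oo] --> x -> v n @[n --> \oo] --> y ->
  u' n @[n --> \oo] --> x' -> v' n @[n --> \oo] --> y' ->
  (forall n, ip (u n) (v n) = ip (u' n) (v' n)) -> ip x y = ip x' y'.
Proof.
move=> ux vy ux' vy' e; have c := cvg_ip ux vy; apply: (norm_cvg_unique c).
have -> : (fun n => ip (u n) (v n)) = (fun n => ip (u' n) (v' n)).
  exact/funext.
exact: cvg_ip.
Qed.

End InnerProductContinuity.

(** * Adjointable maps and the square root of 1 - B *)

Section AdjointMaps.
Variables (R : realType) (A : cstarAlgType R) (H : hilbertModType A).
Implicit Types (S T : H -> H) (x y : H).

Lemma is_adjointPZ T S k x y :
  is_adjoint T S -> T (k *: x + y) = k *: T x + T y.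
Proof.
move=> /is_adjoint_sym TS; apply: ip_inj => z.
by rewrite -TS !ipDr !ipZr !TS.
Qed.

Lemma is_adjoint_add T S x y : is_adjoint T S -> T (x + y) = T x + T y.
Proof. by move=> TS; rewrite -[x]scale1r (is_adjointPZ _ _ _ TS) !scale1r. Qed.

Lemma is_adjoint_eq0 T S : is_adjoint T S -> T 0 = 0.
Proof.
by move=> TS; apply: (addIr (T 0)); rewrite -(is_adjoint_add _ _ TS) !add0r.
Qed.

Lemma is_adjoint_scale T S k x : is_adjoint T S -> T (k *: x) = k *: T x.
Proof.
move=> TS; rewrite -[k *: x]addr0 (is_adjointPZ _ _ _ TS).
by rewrite (is_adjoint_eq0 TS) addr0.
Qed.

Lemma is_adjoint_sub T S x y : is_adjoint T S -> T (x - y) = T x - T y.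
Proof.
move=> TS; rewrite (is_adjoint_add _ _ TS); congr (_ + _).
by rewrite -scaleN1r (is_adjoint_scale _ _ TS) scaleN1r.
Qed.

Lemma norm_self_adjoint T x : is_adjoint T T -> T (T x) = x -> `|T x| = `|x|.
Proof. by move=> TT Tx; apply: eq_norm_ip; rewrite TT Tx. Qed.

Lemma seq_continuous_contraction T S :
  is_adjoint T S -> (forall y, `|T y| <= `|y|) -> seq_continuous T.
Proof.
move=> TS Tc u x /cvgrPdist_lt ux; apply/cvgrPdist_lt => e e0.
have [N _ hN] := ux e e0; exists N => // n Nn /=.
by rewrite -(is_adjoint_sub _ _ TS) (le_lt_trans (Tc _)) //; exact: hN.
Qed.

End AdjointMaps.

Section SquareRoot.
Variables (R : realType) (A : cstarAlgType R) (H : hilbertModType A).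
Variable B : H -> H.
Hypotheses (BB : is_adjoint B B) (Bc : forall x, `|B x| <= `|x|).

(** A fixed point Y = (B + Y^2) / 2 is 1 - sqrt (1 - B). Started from 0, the
    recursion gives polynomials in B with nonnegative coefficients, whose norms
    are controlled by their values at 1. *)
Fixpoint sqrt_iter n : H -> H :=
  if n is m.+1
  then fun x => 2%:R^-1 *: (B x + sqrt_iter m (sqrt_iter m x)) else fun=> 0.

(** The same recursion on numbers, with the norm bound 1 in place of B: it
    dominates the operator recursion, is nondecreasing and bounded by 1. *)
Fixpoint sqrt_bound n : R :=
  if n is m.+1 then (1 + sqrt_bound m ^+ 2) / 2%:R else 0.

Lemma sqrt_iter_adjoint n : is_adjoint (sqrt_iter n) (sqrt_iter n).
Proof.
elim: n => [|n IH] x y /=; first by rewrite ip0l ip0r.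
by rewrite ipZl ipZr ipDl ipDr BB !IH fmorphV rmorph_nat.
Qed.

Lemma sqrt_iter_comm T S n x : is_adjoint T S -> (forall y, T (B y) = B (T y)) ->
  T (sqrt_iter n x) = sqrt_iter n (T x).
Proof.
move=> TS TB; elim: n x => [|n IH] x /=; first by rewrite (is_adjoint_eq0 TS).
by rewrite (is_adjoint_scale _ _ TS) (is_adjoint_add _ _ TS) TB !IH.
Qed.

Lemma sqrt_bound_itv n : 0 <= sqrt_bound n <= 1.
Proof. by elim: n => [|n /andP[h0 h1]] /=; apply/andP; split; nra. Qed.

Lemma sqrt_bound_leS n : sqrt_bound n <= sqrt_bound n.+1.
Proof. by have := sqr_ge0 (sqrt_bound n - 1); rewrite /=; nra. Qed.

Lemma sqrt_bound_le m n : (m <= n)%N -> sqrt_bound m <= sqrt_bound n.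
Proof. exact: homo_leq (@lexx _ _) (@le_trans _ _) sqrt_bound_leS m n. Qed.

Lemma sqrt_bound_cauchy (e : R) : 0 < e ->
  exists N, forall n, (N <= n)%N -> sqrt_bound n - sqrt_bound N < e.
Proof.
move=> e0; have bl : {homo sqrt_bound : m n / (m <= n)%N >-> m <= n}.
  exact: sqrt_bound_le.
have ub : has_ubound (range sqrt_bound).
  by exists 1 => _ [n _ <-]; have /andP[] := sqrt_bound_itv n.
have cvgb := nondecreasing_is_cvgn bl ub.
have [N _ hN] := (cvgrPdist_lt _ _).1 cvgb e e0.
exists N => n Nn; have /= := hN N (leqnn N).
have bN := nondecreasing_cvgn_le bl cvgb n.
apply: le_lt_trans; apply: le_trans (ler_norm _); exact: lerB.
Qed.

Lemma sqrt_iter_norm n x : `|sqrt_iter n x| <= (sqrt_bound n)%:C%C * `|x|.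
Proof.
elim: n x => [|n IH] x; first by rewrite /= normr0 mul0r.
have /andP[b0 _] := sqrt_bound_itv n.
rewrite /= norm_half rmorphM fmorphV rmorph_nat [leRHS]mulrAC [leRHS]mulrC.
rewrite ler_wpM2l //.
apply: (le_trans (ler_normD _ _)); rewrite rmorphD rmorph1 mulrDl mul1r lerD //.
apply: (le_trans (IH _)); rewrite rmorphXn expr2 -mulrA ler_wpM2l //.
by rewrite ler0c.
Qed.

(** Since Y'^2 - Y^2 = (Y' - Y) Y' + Y (Y' - Y), the increments of the operator
    recursion are dominated by those of the numerical one, which telescope. *)
Lemma sqrt_iter_step n x : `|sqrt_iter n.+1 x - sqrt_iter n x| <=
  (sqrt_bound n.+1 - sqrt_bound n)%:C%C * `|x|.
Proof.
elim: n x => [|n IH] x.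
  have := sqrt_iter_norm 1 x.
  by rewrite [sqrt_iter 0 x]/= [sqrt_bound 0]/= !subr0.
have /andP[b0 _] := sqrt_bound_itv n; have /andP[b1 _] := sqrt_bound_itv n.+1.
set Y' := sqrt_iter n.+1; set Y := sqrt_iter n; pose d y := Y' y - Y y.
have Yd : Y (d x) = Y (Y' x) - Y (Y x).
  exact: (is_adjoint_sub _ _ (sqrt_iter_adjoint n)).
have -> : sqrt_iter n.+2 x - Y' x = 2%:R^-1 *: (d (Y' x) + Y (d x)).
  rewrite {2}/Y' /= -scalerBr -/Y -/Y' opprD addrACA subrr add0r.
  by rewrite Yd /d subrKA.
have -> : sqrt_bound n.+2 - sqrt_bound n.+1 = 2%:R^-1 *
    ((sqrt_bound n.+1 - sqrt_bound n) * sqrt_bound n.+1 +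
     sqrt_bound n * (sqrt_bound n.+1 - sqrt_bound n)).
  by rewrite /=; lra.
rewrite norm_half rmorphM fmorphV rmorph_nat -mulrA ler_wpM2l //.
have b2 : 0 <= sqrt_bound n.+1 - sqrt_bound n.
  by rewrite subr_ge0 sqrt_bound_leS.
apply: (le_trans (ler_normD _ _)).
rewrite rmorphD (rmorphM _ (_ - _)) (rmorphM _ (sqrt_bound n)) mulrDl lerD //.
  apply: (le_trans (IH _)); rewrite -mulrA ler_wpM2l ?ler0c //.
  exact: sqrt_iter_norm.
apply: (le_trans (sqrt_iter_norm _ _)); rewrite -mulrA ler_wpM2l ?ler0c //.
exact: IH.
Qed.

Lemma sqrt_iter_dist m n x : (m <= n)%N ->
  `|sqrt_iter n x - sqrt_iter m x| <=
  (sqrt_bound n - sqrt_bound m)%:C%C * `|x|.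
Proof.
elim: n => [|n IH].
  by rewrite leqn0 => /eqP ->; rewrite !subrr normr0 mul0r.
rewrite leq_eqVlt => /orP[/eqP ->|]; first by rewrite !subrr normr0 mul0r.
rewrite ltnS => mn; rewrite -(subrKA (sqrt_iter n x)).
rewrite -(subrKA (sqrt_bound n)) rmorphD mulrDl.
apply: (le_trans (ler_normD _ _)); apply: lerD; last exact: IH.
exact: sqrt_iter_step.
Qed.

Lemma sqrt_iter_cvg x : exists y : H, sqrt_iter n x @[n --> \oo] --> y.
Proof.
apply: cvg_of_cauchy => e e0; have x1 : 0 < `|x| + 1 by rewrite ltr_wpDl.
have d0 : 0 < e / (`|x| + 1) by rewrite divr_gt0.
have de := RRe_real (gtr0_real d0); move: d0; rewrite -de.
rewrite -[0]/(0%:C%C) ltcR => /sqrt_bound_cauchy[N hN].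
exists N => n Nn; rewrite distrC (le_lt_trans (sqrt_iter_dist _ Nn)) //.
have := hN n Nn; rewrite -ltcR de ltr_pdivlMr //; apply: le_lt_trans.
by rewrite ler_wpM2l ?lerDl // ler0c subr_ge0 sqrt_bound_le.
Qed.

(** The square root S of 1 - B for a self-adjoint contraction B, with no
    functional calculus. It is a pointwise limit of polynomials in B, hence
    commutes with every adjointable map that commutes with B. *)
Lemma sqrt_exists : exists S : H -> H,
  [/\ is_adjoint S S, forall x, S (S x) = x - B x &
   forall T T', is_adjoint T T' -> (forall x, T (B x) = B (T x)) ->
     forall x, T (S x) = S (T x)].
Proof.
have /choice[Y Ylim] := sqrt_iter_cvg.
have lcst (z : H) : z @[_ --> \oo] --> z by exact: cvg_cst.
have YY : is_adjoint Y Y.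
  move=> x y; apply: (ip_lim_eq (Ylim x) (lcst y) (lcst x) (Ylim y)) => n.
  exact: sqrt_iter_adjoint.
have Yeq x : Y x + Y x = B x + Y (Y x).
  apply: ip_inj => z; rewrite [RHS]ipDr -YY.
  have shift : sqrt_iter n.+1 x @[n --> \oo] --> Y x.
    by have := Ylim x; rewrite -(cvg_shiftS (sqrt_iter ^~ x)).
  have c2 : sqrt_iter n.+1 x + sqrt_iter n.+1 x @[n --> \oo] --> Y x + Y x.
    exact: cvgD.
  have c := cvg_ip (lcst z) c2.
  have c' := cvgD (cvg_ip (lcst z) (lcst (B x))) (cvg_ip (Ylim z) (Ylim x)).
  apply: (norm_cvg_unique c).
  have -> : (fun n => ip z (sqrt_iter n.+1 x + sqrt_iter n.+1 x)) =
      (fun n => ip z (B x) + ip (sqrt_iter n z) (sqrt_iter n x)).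
    apply/funext => n; rewrite [in RHS]sqrt_iter_adjoint -ipDr /=.
    rewrite -scalerDl -[X in X + X]mul1r -mulrDl -[1 + 1]/(2%:R).
    by rewrite mulfV ?pnatr_eq0 // scale1r.
  exact: c'.
exists (fun x => x - Y x); split=> [x y|x|T T' TT' TB x].
- by rewrite ipBl ipBr YY.
- rewrite (is_adjoint_sub _ _ YY) opprB [Y (Y x) - _]addrC addrA.
  by rewrite -[x - Y x - Y x]addrA -opprD Yeq opprD addrA subrK.
- rewrite (is_adjoint_sub _ _ TT'); congr (_ - _); apply: ip_inj => z.
  rewrite -(is_adjoint_sym TT').
  apply: (ip_lim_eq (lcst _) (Ylim x) (lcst z) (Ylim _)) => n.
  by rewrite (is_adjoint_sym TT') (sqrt_iter_comm _ _ TT').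
Qed.

End SquareRoot.

(** * The sign of a self-adjoint operator *)

Definition range_plus_null (V : zmodType) (S D : V -> V) : set V :=
  [set S x + z | x in setT & z in [set z | D z = 0]].

Section SignOperator.
Variables (R : realType) (A : cstarAlgType R) (H : hilbertModType A).
Variables S D : H -> H.
Hypotheses (SS : is_adjoint S S) (DD : is_adjoint D D).
Hypotheses (SD : forall x, S (D x) = D (S x)) (S2 : forall x, S (S x) = D (D x)).
Hypothesis dense : closure (range_plus_null S D) = setT.

(* The closure of the graph of S x + z |-> D x + z. *)
Let sign_graph (h u : H) := exists x z : nat -> H, [/\ forall n, D (z n) = 0,
  S (x n) + z n @[n --> \oo] --> h & D (x n) + z n @[n --> \oo] --> u].

Lemma null_sqrt z : D z = 0 -> S z = 0.
Proof. by move=> Dz; apply: ip_eq0; rewrite SS S2 Dz (is_adjoint_eq0 DD) ip0r. Qed.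

(** The ranges of S and D are orthogonal to the null space of D, and S^2 = D^2:
    the correspondence S x + z |-> D x + z preserves inner products, hence norms,
    which makes it single-valued and extendable to the closure. *)
Lemma sign_ip x z y w : D z = 0 -> D w = 0 ->
  ip (D x + z) (D y + w) = ip (S x + z) (S y + w).
Proof.
move=> Dz Dw; have Sz := null_sqrt Dz; have Sw := null_sqrt Dw.
rewrite !ipDl !ipDr DD SS S2 [ip (D x) w]DD Dw [ip (S x) w]SS Sw.
by rewrite -[ip z (D y)]DD Dz -[ip z (S y)]SS Sz !ip0l.
Qed.

(** The correspondence is also symmetric, because S and D commute; symmetry
    makes its extension adjointable. *)
Lemma sign_sym x z y w : D z = 0 -> D w = 0 ->
  ip (D x + z) (S y + w) = ip (S x + z) (D y + w).
Proof.
move=> Dz Dw; have Sz := null_sqrt Dz; have Sw := null_sqrt Dw.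
rewrite !ipDl !ipDr DD SS SD [ip (D x) w]DD Dw [ip (S x) w]SS Sw.
by rewrite -[ip z (D y)]DD Dz -[ip z (S y)]SS Sz !ip0l.
Qed.

Lemma sign_norm x z : D z = 0 -> `|D x + z| = `|S x + z|.
Proof. by move=> Dz; apply: eq_norm_ip; exact: sign_ip. Qed.

Lemma sign_graph_total h : exists u, sign_graph h u.
Proof.
have : closure (range_plus_null S D) h by rewrite dense.
move=> /closureP[v [vE vh]].
have /choice[x /choice[z xz]] : forall n, exists x z, D z = 0 /\ S x + z = v n.
  by move=> n; have [x _ [z Dz e]] := vE n; exists x, z.
have Dz n : D (z n) = 0 by have [] := xz n.
have {xz} vE' n : S (x n) + z n = v n by have [] := xz n.
have [|u uP] := @cvg_of_cauchy _ _ (fun n => D (x n) + z n).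
  move=> e e0; have e2 : 0 < e / 2%:R by rewrite divr_gt0 ?ltr0n.
  have [N _ hN] := (cvgrPdist_lt _ _).1 vh _ e2; exists N => n Nn.
  rewrite opprD addrACA -(is_adjoint_sub _ _ DD) sign_norm; last first.
    by rewrite (is_adjoint_sub _ _ DD) !Dz subrr.
  rewrite (is_adjoint_sub _ _ SS) -addrACA -opprD !vE' [e]splitr.
  rewrite -(subrKA h) (le_lt_trans (ler_normD _ _)) //.
  by rewrite ltrD // ?(distrC _ h); apply: hN => //=.
exists u, x, z; split=> //.
by have -> : (fun n => S (x n) + z n) = v by exact/funext.
Qed.

(** The extension U is the sign of D on the closure of the range of D, and the
    identity on its null space. Being isometric and self-adjoint, U is its own
    inverse. *)
Lemma sign_exists : exists U : H -> H,
  [/\ is_adjoint U U, forall h, U (U h) = h &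
   forall x z, D z = 0 -> U (S x + z) = D x + z].
Proof.
have /choice[U UP] := sign_graph_total.
have sym h u k v : sign_graph h u -> sign_graph k v -> ip u k = ip h v.
  move=> [x [z [Dz xh xu]]] [y [w [Dw yk yv]]].
  by apply: (ip_lim_eq xu yk xh yv) => n; exact: sign_sym.
have iso h u k v : sign_graph h u -> sign_graph k v -> ip u v = ip h k.
  move=> [x [z [Dz xh xu]]] [y [w [Dw yk yv]]].
  by apply: (ip_lim_eq xu yv xh yk) => n; exact: sign_ip.
have UU : is_adjoint U U by move=> h k; exact: sym.
exists U; split=> // [h|x z Dz].
  by apply: ip_inj => k; rewrite -UU; exact: iso.
apply: ip_inj => k; rewrite -UU; apply: sym (UP k) _.
by exists (fun=> x), (fun=> z); split=> //; exact: cvg_cst.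
Qed.

End SignOperator.

(** * Projections *)

Section Projections.
Variables (R : realType) (A : cstarAlgType R) (H : hilbertModType A).
Implicit Types (P Q : adjop H) (x y b : H).

Lemma adjopB P x y : P (x - y) = P x - P y.
Proof. exact: (is_adjoint_sub _ _ (adjointP P)). Qed.

Lemma adjop_eq0 P : P 0 = 0.
Proof. exact: (is_adjoint_eq0 (adjointP P)). Qed.

Lemma projK P x : projection P -> P (P x) = P x.
Proof. by move=> [_ PP]; rewrite -adjopME PP. Qed.

Lemma eq_adjoint P (T : H -> H) : is_adjoint P T -> adjoint P = T :> (H -> H).
Proof. exact: is_adjoint_unique (adjointP P). Qed.

Lemma projectionC P : projection P -> projection (1 - P).
Proof.
move=> pP; split; last first.
  by rewrite mulrBl mul1r mulrBr mulr1 pP.2 subrr subr0.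
apply: val_inj; apply: eq_adjoint => x y.
by rewrite /= ipBl ipBr (projection_adjoint pP).
Qed.

Lemma norm_reflection P x : projection P -> `|P x + P x - x| = `|x|.
Proof.
move=> pP; have aP := projection_adjoint pP.
apply: (@norm_self_adjoint _ _ _ (fun x => P x + P x - x)) => [y z|].
  by rewrite ipBl ipBr ipDl ipDr aP.
by rewrite adjopB !adjopD !projK // addrK opprB addrC subrK.
Qed.

(** P is the midpoint of the identity and of the reflection 2P - 1, which is
    isometric because it is a self-adjoint involution. This bounds P without
    comparing positive elements of the C*-algebra. *)
Lemma norm_projection P x : projection P -> `|P x| <= `|x|.
Proof.
move=> pP; have -> : P x = 2%:R^-1 *: ((P x + P x - x) + x).
  by rewrite subrK half_add.
by rewrite norm_half_add // norm_reflection.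
Qed.

(** P + Q - 1 is the midpoint of the reflections 2P - 1 and 2Q - 1. *)
Lemma norm_projection_sum P Q x : projection P -> projection Q ->
  `|P x + Q x - x| <= `|x|.
Proof.
move=> pP pQ; have -> : P x + Q x - x =
    2%:R^-1 *: ((P x + P x - x) + (Q x + Q x - x)).
  rewrite [in RHS](addrACA (P x + P x)) (addrACA (P x) (P x)).
  by rewrite (addrACA (P x + Q x)) half_add.
by rewrite norm_half_add // norm_reflection.
Qed.

Lemma seq_continuous_projection P : projection P -> seq_continuous P.
Proof.
move=> pP; apply: (seq_continuous_contraction (projection_adjoint pP)) => y.
exact: norm_projection.
Qed.

(** Put r = P b = - Q b. Then r lies in both ranges, so that
    [ip r r = ip b r = - ip r r]. *)
Lemma projection_sum_eq0 P Q b : projection P -> projection Q ->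
  P b + Q b = 0 -> P b = 0.
Proof.
move=> pP pQ; move/eqP; rewrite addrC addr_eq0 => /eqP QbP.
have Qr : Q (P b) = P b.
  have -> : P b = - Q b by rewrite QbP opprK.
  by rewrite -[- Q b]sub0r adjopB adjop_eq0 projK.
apply: ip_eq0; rewrite -[LHS]half_add -[X in _ *: (_ + X)]opprK -ipNl -QbP.
rewrite (projection_adjoint pQ) Qr {1}(projection_adjoint pP) projK //.
by rewrite subrr scaler0.
Qed.

Lemma orthogonal_range_sum P Q : projection P -> projection Q ->
  Defs.orthogonal (closure (range (P + Q))) = null Q `&` null P.
Proof.
move=> pP pQ; have aP := projection_adjoint pP; have aQ := projection_adjoint pQ.
apply/seteqP; split=> [b ob|b [/= Qb Pb] y /closureP[u [uE uy]]].
  have s0 : P b + Q b = 0.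
    apply: ip_inj => z; rewrite ip0r ipDr -aP -aQ -ipDl -ip_star.
    by rewrite ob ?cstar0 //; apply: subset_closure; exists z.
  have s0' : Q b + P b = 0 by rewrite addrC.
  split; first exact: projection_sum_eq0 pQ pP s0'.
  exact: projection_sum_eq0 pP pQ s0.
have lcst (z : H) : z @[_ --> \oo] --> z by exact: cvg_cst.
rewrite -[RHS](ip0l (0 : H)).
apply: (ip_lim_eq (lcst b) uy (lcst 0) (lcst 0)) => n.
have [w _ <-] := uE n.
by rewrite /= ipDr -aP -aQ Pb Qb !ip0l addr0.
Qed.

Lemma orth_complemented_orthogonal (M : set H) :
  orth_complemented M -> orth_complemented (Defs.orthogonal M).
Proof.
move=> cM; apply/seteqP; split=> // h _; have : [set: H] h by [].
rewrite cM => -[a Ma [b ob <-]]; exists b => //; exists a; last by rewrite addrC.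
by move=> y oy; exact: Defs.orthogonalP oy Ma.
Qed.

Lemma semi_harmonious_complemented P Q : projection P -> projection Q ->
  orth_complemented (closure (range (P + Q))) ->
  orth_complemented (null Q `&` null P).
Proof.
by move=> pP pQ /orth_complemented_orthogonal; rewrite orthogonal_range_sum.
Qed.

Lemma nullC P : projection P -> null (1 - P) = range P.
Proof.
move=> pP; apply/seteqP; split=> x.
  move=> /eqP; rewrite -[_ x]/(x - P x) subr_eq0 => /eqP Px.
  by exists x.
by move=> /(projection_range pP) Px; rewrite /null /= -[LHS]/(x - P x) Px subrr.
Qed.

End Projections.

(** * Pairs of projections *)

Section ProjectionPair.
Variables (R : realType) (A : cstarAlgType R) (H : hilbertModType A).
Variables P Q : adjop H.
Hypotheses (pP : projection P) (pQ : projection Q).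

Let D x := P x - Q x.
Let T x := P x + Q x - x.

Lemma pair_diff_sqr x :
  D (D x) = P x + Q x - (P (Q x) + Q (P x)).
Proof.
by rewrite /D !adjopB !projK // opprB addrACA -opprD.
Qed.

(** With T = P + Q - 1 and D = P - Q, this is T^2 + D^2 = 1: the operator 1 - D^2
    is the square of a contraction, hence a contraction. *)
Lemma pair_sum_sqr x : T (T x) = x - D (D x).
Proof.
rewrite pair_diff_sqr /T !adjopB !adjopD !projK //.
by rewrite [P x + P (Q x)]addrC !addrK !opprB addrCA.
Qed.

(** D P = (1 - Q) D: the difference exchanges P with 1 - Q and Q with 1 - P. *)
Lemma pair_swapP x : D (P x) = D x - Q (D x).
Proof. by rewrite /D adjopB !projK // opprB subrKA. Qed.

Lemma pair_swapQ x : D (Q x) = D x - P (D x).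
Proof. by rewrite /D adjopB !projK // opprB [RHS]addrC subrKA. Qed.


(** D^2 = (P + Q) (2 - P - Q). *)
Lemma range_compl_sum_sqr y : range (2%:R - P - Q) y ->
  exists w, P y + Q y = D (D w).
Proof.
move=> [w _ <-]; exists w; rewrite -[(2%:R - P - Q) w]/(w + w - P w - Q w).
rewrite !adjopB !adjopD !projK // addrK [Q w + Q w - _]addrAC addrK.
by rewrite pair_diff_sqr addrACA -opprD.
Qed.

Lemma compl_sum : (1 - P) + (1 - Q) = 2%:R - P - Q.
Proof. by rewrite addrACA -opprD opprD addrA. Qed.

Lemma complemented_ranges : orth_complemented (closure (range (2%:R - P - Q))) ->
  Defs.orthogonal (closure (range (2%:R - P - Q))) = range Q `&` range P /\
  orth_complemented (range Q `&` range P).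
Proof.
rewrite -compl_sum => h; have pP' := projectionC pP; have pQ' := projectionC pQ.
have := semi_harmonious_complemented pP' pQ' h.
by rewrite orthogonal_range_sum // !nullC.
Qed.

(** This is where semi-harmony enters. H is the sum of the closure of the range
    of P + Q and of its orthogonal, where P = Q = 0; in turn (P + Q) y splits along
    the closure of the range of 2 - P - Q and its orthogonal, where P = Q = 1. Up to
    elements of the null space of D = P - Q, everything is therefore a limit of
    vectors (P + Q) (2 - P - Q) w = D^2 w = S (S w). *)
Lemma pair_dense (S : H -> H) : semi_harmonious P Q ->
  (forall x, S (S x) = D (D x)) ->
  closure (range_plus_null S D) = setT.
Proof.
set E := range_plus_null S D => -[cS cC] S2.
have aP := projection_adjoint pP; have aQ := projection_adjoint pQ.
have ED x z : D z = 0 -> closure E (D (D x) + z).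
  by move=> Dz; apply: subset_closure; exists (S x) => //; exists z; rewrite ?S2.
have D0 z : P z = Q z -> D z = 0 by move=> e; rewrite /D e subrr.
have shift z : D z = 0 -> forall x : H, closure E x -> closure E (x + z).
  move=> Dz; apply: (@seq_continuous_closure _ _ (fun x => x + z)) => [u x ux|].
    by apply: cvgD => //; exact: cvg_cst.
  move=> _ [x _ [w Dw <-]]; apply: subset_closure; exists x => //.
  exists (w + z); last by rewrite addrA.
  by rewrite /= /D !adjopD opprD addrACA -/(D w) -/(D z) Dw Dz addr0.
have sumc : seq_continuous (fun x => P x + Q x).
  by move=> u x ux; apply: cvgD; apply: seq_continuous_projection.
have clE x : closure (range (2%:R - P - Q)) x -> closure E (P x + Q x).
  apply: (seq_continuous_closure sumc) => y /range_compl_sum_sqr[w ->].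
  by rewrite -[D (D w)]addr0; apply: ED; rewrite /D !adjop_eq0 subrr.
have [oC cR] := complemented_ranges cC.
apply/seteqP; split=> // h _; have : [set: H] h by [].
rewrite cS => -[a Ca [b]]; rewrite orthogonal_range_sum // => -[/= Qb Pb] <-.
apply: (shift b); first by apply: D0; rewrite Qb Pb.
apply: (@seq_continuous_closure _ _ id _ _ _ _ a Ca) => // _ [y _ <-].
have : [set: H] y by [].
rewrite cC oC => -[c Cc [r [rQ rP] <-]].
rewrite -[(P + Q) _]/(P (c + r) + Q (c + r)) !adjopD addrACA.
apply: shift; last exact: clE.
by apply: D0; rewrite !adjopD (projection_range pP rP) (projection_range pQ rQ)
  (projection_range pP rP) (projection_range pQ rQ).
Qed.

End ProjectionPair.

(** * The unitary *)

Section Intertwining.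
Variables (R : realType) (A : cstarAlgType R) (H : hilbertModType A).

(** On the dense set of vectors S x + z, the operator Q - PR gives S (Q x), which U
    sends to D (Q x) = (1 - P) (D x); this is 1 - P - PN applied to D x + z, the
    image of S x + z. Continuity does the rest. *)
Lemma projection_swap (S D U : H -> H) (P Q PR PN : adjop H) :
  projection P -> projection Q -> projection PR -> projection PN ->
  D 0 = 0 ->
  closure (range_plus_null S D) = setT ->
  is_adjoint U U -> (forall h, U (U h) = h) ->
  (forall x z, D z = 0 -> U (S x + z) = D x + z) ->
  (forall x, Q (S x) = S (Q x)) -> (forall x, D (Q x) = D x - P (D x)) ->
  (forall x, PR (S x) = 0) -> (forall x, PN (D x) = 0) ->
  (forall z, D z = 0 -> Q z = PR z) -> (forall z, D z = 0 -> z - P z = PN z) ->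
  forall h, U (Q (U h) - PR (U h)) = h - P h - PN h.
Proof.
move=> pP pQ pR pN D0 dense UU UK UE QS DQ RS ND QR PN' h.
have contU : seq_continuous U.
  by apply: (seq_continuous_contraction UU) => y; rewrite norm_self_adjoint.
suff gen k : U (Q k - PR k) = U k - P (U k) - PN (U k) by rewrite gen !UK.
apply: (seq_continuous_dense (f := fun k => U (Q k - PR k))
  (g := fun k => U k - P (U k) - PN (U k)) _ _ _ dense) => [u x ux|u x ux|].
- by apply: contU; apply: seq_continuousB => //; exact: seq_continuous_projection.
- have Ux := contU _ _ ux.
  have PU := seq_continuous_projection pP Ux.
  have NU := seq_continuous_projection pN Ux.
  by apply: cvgB => //; exact: cvgB.
- move=> _ [x _ [z Dz <-]].
  rewrite (UE _ _ Dz) !adjopD QS RS add0r (QR z Dz) addrK.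
  rewrite -[S (Q x)]addr0 UE // addr0 DQ ND add0r -(PN' z Dz).
  by rewrite opprD addrACA addrK.
Qed.

End Intertwining.

Theorem theorem3p3 (R : realType) (A : cstarAlgType R) (H : hilbertModType A)
    (P Q : adjop H) (hP : projection P) (hQ : projection Q)
    (hPQ : semi_harmonious P Q) :
  let PR : adjop H := proj_on (range Q `&` range P) in
  let PN : adjop H := proj_on (null Q `&` null P) in
  exists U : adjop H, unitary U /\
    U * (Q - PR) * adjoint U = 1 - P - PN /\
    U * (P - PR) * adjoint U = 1 - Q - PN.
Proof.
move=> PR PN; have [cS cC] := hPQ.
have [pR rR] := proj_onP (complemented_ranges hP hQ cC).2.
have [pN rN] := proj_onP (semi_harmonious_complemented hP hQ cS).
rewrite -/PR in pR rR; rewrite -/PN in pN rN.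
have aP := projection_adjoint hP; have aQ := projection_adjoint hQ.
have aR := projection_adjoint pR; have aN := projection_adjoint pN.
pose D x := P x - Q x; pose T x := P x + Q x - x.
have DD : is_adjoint D D by move=> x y; rewrite ipBl ipBr aP aQ.
have TT : is_adjoint T T by move=> x y; rewrite ipBl ipBr ipDl ipDr aP aQ.
have Tc x : `|T x| <= `|x| by exact: norm_projection_sum.
have BB : is_adjoint (T \o T) (T \o T) by move=> x y; rewrite /= !TT.
have Bc x : `|(T \o T) x| <= `|x| by exact: le_trans (Tc _) (Tc _).
have [S [SS S2 Scomm]] := sqrt_exists BB Bc.
have TE x : T (T x) = x - D (D x) by exact: pair_sum_sqr.
have {}S2 x : S (S x) = D (D x).
  by rewrite S2 /= TE subKr.
have DP x : D (P x) = D x - Q (D x) by exact: pair_swapP.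
have DQ x : D (Q x) = D x - P (D x) by exact: pair_swapQ.
have DB x y : D (x - y) = D x - D y by exact: is_adjoint_sub DD.
have SD x : S (D x) = D (S x).
  by rewrite -(Scomm _ _ DD) // => y; rewrite /= !TE !DB.
have DDP x : P (D (D x)) = D (D (P x)).
  by rewrite DP (DB _ (Q (D x))) (DQ (D x)) subKr.
have DDQ x : Q (D (D x)) = D (D (Q x)).
  by rewrite DQ (DB _ (P (D x))) (DP (D x)) subKr.
have PS x : P (S x) = S (P x).
  by rewrite -(Scomm _ _ aP) // => y; rewrite /= !TE adjopB DDP.
have QS x : Q (S x) = S (Q x).
  by rewrite -(Scomm _ _ aQ) // => y; rewrite /= !TE adjopB DDQ.
have dense := pair_dense hP hQ hPQ S2.
have [U [UU UK UE]] := sign_exists SS DD SD S2 dense.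
have aU : U \in @adjointable _ _ H by apply/asboolP; exists U.
pose V := AdjOp aU; have VV : adjoint V = V by apply: val_inj; exact: eq_adjoint.
have DE z : D z = 0 -> P z = Q z by move/eqP; rewrite subr_eq0 => /eqP.
have inR x : Q (PR x) = PR x /\ P (PR x) = PR x.
  have : range PR (PR x) by exists x.
  by rewrite rR => -[q p]; rewrite (projection_range hP p) (projection_range hQ q).
have inN x : Q (PN x) = 0 /\ P (PN x) = 0.
  have : range PN (PN x) by exists x.
  by rewrite rN => -[].
have RS x : PR (S x) = 0.
  apply: ip_inj => w; rewrite ip0r -aR -SS (null_sqrt SS DD S2) ?ip0l //.
  by rewrite /D (inR w).1 (inR w).2 subrr.
have ND x : PN (D x) = 0.
  apply: ip_inj => w; rewrite ip0r -aN -DD /D (inN w).1 (inN w).2.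
  by rewrite subrr ip0l.
have PzR z : D z = 0 -> P z = PR z.
  (* z = P z + (z - P z), with P z in the range of PR and z - P z in that of PN *)
  move=> /DE e; have : range PR (P z).
    by rewrite rR; split; [exists (Q z); rewrite ?projK // e | exists z].
  move=> /(projection_range pR) {1}<-; apply: ip_inj => w; rewrite -!aR.
  by rewrite -[PR w in LHS](inR w).2 aP projK // -aP (inR w).2.
have PzN z : D z = 0 -> z - P z = PN z.
  move=> /DE e; have : range PN (z - P z).
    by rewrite rN; split; rewrite /null /= adjopB ?projK // e ?projK // subrr.
  move=> /(projection_range pN) {1}<-; apply: ip_inj => w; rewrite -!aN.
  by rewrite ipBr -aP (inN w).2 ip0l subr0.
have QzR z : D z = 0 -> Q z = PR z by move=> Dz; rewrite -PzR // DE.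
have QzN z : D z = 0 -> z - Q z = PN z by move=> Dz; rewrite -PzN // DE.
have D0 : D 0 = 0 by exact: is_adjoint_eq0 DD.
exists V; rewrite /unitary VV; split; last split.
- by split; apply/adjopP => h; exact: UK.
- by apply/adjopP => h; exact: (projection_swap hP hQ pR pN D0 dense UU UK UE).
- by apply/adjopP => h; exact: (projection_swap hQ hP pR pN D0 dense UU UK UE).
Qed.
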